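(* Let $D$ be a linearly connected digraph with exactly $\eta$ strong components $D_1,\ldots,D_\eta$. Then the graph sequence $\{C(D^m)\}_{m=1}^{\infty}$ converges if and only if one of the following is true: (i) for each $i=1,\ldots,\eta$, $D_i$ is trivial; (ii) $D_\eta$ is nontrivial; (iii) $D_\eta$ is trivial whereas there is a nontrivial strong component in $D$, and, if $p$ is the largest index for which $D_p$ is a nontrivial component, then $$\bigcup_{i=0}^{\eta-p-1}\bigl((i+L_{j_1\to v})\cap(i+L_{j_2\to v})\bigr)=\emptyset \text{ or } \mathbb{Z}_{\kappa_p}$$ for any $j_1,j_2$ in $\mathbb{Z}_{\kappa_p}$, where $V(D_{p+1})=\{v\}$ and $\Lambda(D)=\{i \mid U^{(p)}_i\cap N_D^-(v)\neq\emptyset\}=\{k_1,\ldots,k_s\}$ for some integer $s$, $1\le s\le \kappa_p$.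
   Context: All digraphs are finite and simple (no loops, no multiple arcs; a pair of opposite arcs is allowed). A strong component is trivial if it has exactly one vertex, and nontrivial otherwise. A digraph $D$ is linearly connected if it is weakly connected and its strong components can be listed as $D_1,\ldots,D_\eta$ so that every arc of $D$ joining two different strong components goes from $D_i$ to $D_{i+1}$ for some $i\in\{1,\ldots,\eta-1\}$; this listing is fixed. For a nontrivial strong component $D_i$, $\kappa_i$ denotes its index of imprimitivity (the gcd of the lengths of all its directed cycles) and $U^{(i)}_1,\ldots,U^{(i)}_{\kappa_i}$ its sets of imprimitivity, i.e. the partition of $V(D_i)$, indexed by $\mathbb{Z}_{\kappa_i}$ (indices read modulo $\kappa_i$), such that every arc of $D_i$ goes from $U^{(i)}_j$ to $U^{(i)}_{j+1}$ for some $j$. $N_D^-(v)$ is the set of in-neighbors of $v$ in $D$. For $p$, $v$ and $\Lambda(D)=\{k_1,\ldots,k_s\}$ as in (iii), for $j\in\mathbb{Z}_{\kappa_p}$ and an integer $i\ge 0$, $$i+L_{j\to v}:=\{(k_r-j)+i+1 \pmod{\kappa_p} \mid r=1,\ldots,s\}\subseteq\mathbb{Z}_{\kappa_p},\qquad L_{j\to v}:=0+L_{j\to v}.$$ For a positive integer $m$, $D^m$ is the digraph on $V(D)$ with an arc $(u,w)$ if and only if there is a directed walk of length $m$ from $u$ to $w$ in $D$. The competition graph $C(D')$ of a digraph $D'$ is the simple graph on $V(D')$ in which two distinct vertices $u,w$ are adjacent if and only if there is a vertex $z$ with both $(u,z)$ and $(w,z)$ arcs of $D'$. A graph sequence $\{G_m\}_{m\ge1}$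 converges if there is $N$ with $G_m=G_N$ for all $m\ge N$; then $G_N$ is its limit.
   Formalization: In (iii) the condition is required only for distinct j_1, j_2; with j_1 = j_2 allowed the claim is false, e.g. for the digraph with arcs a→b, b→a, b→v, where every C(D^m) is edgeless but the union for j_1 = j_2 is a single element of Z_2. *)

(* Defs.v *)
(* A finite simple digraph is a finite type with an irreflexive boolean
   relation [e]; [e x y] means that (x, y) is an arc. *)
From HB Require Import structures.
From mathcomp Require Import all_boot all_order all_algebra.

Set Implicit Arguments.
Unset Strict Implicit.
Unset Printing Implicit Defensive.

Section Digraphs.
Variables (T : finType) (e : rel T).

Definition weakly_connected : Prop :=
  forall x y : T, connect [rel u w | e u w || e w u] x y.

Definition strong_component (x : T) : {set T} :=
  [set y | connect e x y && connect e y x].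

Definition strong_components : {set {set T}} :=
  [set strong_component x | x : T].

Definition trivial_component (A : {set T}) : bool := #|A| == 1.

(* [D 1], ..., [D eta] are the strong components, each listed once; the values
   of [D] at other indices are irrelevant. *)
Definition linear_listing (eta : nat) (D : nat -> {set T}) : Prop :=
  perm_eq [seq D i | i <- iota 1 eta] (enum strong_components) /\
  forall (i j : nat) (x y : T),
    1 <= i <= eta -> 1 <= j <= eta -> i != j ->
    x \in D i -> y \in D j -> e x y -> j = i.+1.

(* The gcd of the lengths of the directed cycles with all vertices in [A]; it
   is 0 if there are none, in particular when [A] is a single vertex. *)
Definition imprimitivity_index (A : {set T}) : nat :=
  \big[gcdn/0]_(1 <= n < #|T|.+1 |
      [exists c : n.-tuple T, ucycleb e c && all (fun x => x \in A) c]) n.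

(* Z_k is represented by 'I_k, with cyclic successor [ordS]: unlike 'Z_k, this
   is also correct for k = 1. *)
Definition imprimitivity_sets (A : {set T}) (k : nat) (U : 'I_k -> {set T})
    : Prop :=
  [/\ injective U,
      partition [set U j | j : 'I_k] A
    & forall x y : T, x \in A -> y \in A -> e x y ->
        exists j : 'I_k, x \in U j /\ y \in U (ordS j)].

Definition in_neighbors (v : T) : {set T} := [set u | e u v].

Definition Lambda (k : nat) (U : 'I_k -> {set T}) (v : T) : {set 'I_k} :=
  [set i | U i :&: in_neighbors v != set0].

Definition shifted_L (k : nat) (U : 'I_k -> {set T}) (v : T) (i : nat)
    (j : 'I_k) : {set 'I_k} :=
  [set l : 'I_k | [exists r : 'I_k, (r \in Lambda U v) &&
     (l%:Z == (r%:Z - j%:Z) + i%:Z + 1 %[mod k%:Z])%Z]].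

Definition digraph_power (m : nat) : rel T :=
  [rel u w | [exists c : m.-tuple T, path e u c && (last u c == w)]].

Definition competition_graph : rel T :=
  [rel u w | (u != w) && [exists z, e u z && e w z]].

End Digraphs.

(* Sequences are indexed by positive integers; [G 0] is irrelevant. *)
Definition graph_sequence_converges (T : finType) (G : nat -> rel T) : Prop :=
  exists2 N : nat, 0 < N & forall m : nat, N <= m -> G m =2 G N.

(* Main.v *)
(** Let p be the last nontrivial component. A common prey in D_1, ..., D_p can be
    followed forever, so it makes the two vertices adjacent at all later steps,
    while vertices beyond p have no long walks at all. What remains are common
    preys on the final path v = v_{p+1}, ..., v_eta. Call c a phase of u if some
    walk of some length n from u ends in the imprimitivity set U_{c+n} of D_p.
    Since D_p is strong with index kappa, for all large m the vertex u then
    reaches every vertex of U_{c+m} in exactly m steps, and so reaches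
    v_{p+1+i} at the times m in i + L_{c -> v}. Hence for large m two vertices
    have a common prey on the path exactly when, for some phases c and c' of
    theirs, m mod kappa lies in the union over i of the intersections of
    i + L_{c -> v} and i + L_{c' -> v}. A vertex of U_j has j as its only phase,
    and for j1 <> j2 a vertex of U_{j1} and one of U_{j2} have no common prey in
    D_p: their adjacency is eventually periodic, and constant only if the union
    is empty or everything. *)
Require Import Defs.
From HB Require Import structures.
From mathcomp Require Import all_boot all_order all_algebra.
From mathcomp Require Import zify.
From Stdlib Require Import Classical.

Set Implicit Arguments.
Unset Strict Implicit.
Unset Printing Implicit Defensive.

(** * Thresholds and numerical semigroups *)

Lemma eventually_forall (I : finType) (P : I -> nat -> Prop) :
  (forall i, exists N, forall n, N <= n -> P i n) ->
  exists N, forall n, N <= n -> forall i, P i n.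
Proof.
move=> evP.
suff /(_ (enum I)) [N NP] : forall s : seq I,
    exists N, forall n, N <= n -> forall i, i \in s -> P i n.
  by exists N => n Nn i; apply: NP; rewrite ?mem_enum.
elim=> [|i s [N NP]]; first by exists 0.
have [M MP] := evP i; exists (maxn M N) => n.
rewrite geq_max => /andP[Mn Nn] j; rewrite inE => /predU1P[-> |]; first exact: MP.
exact: NP.
Qed.

Section Semigroup.
Variable S : nat -> Prop.
Hypotheses (S0 : S 0) (SD : forall m n, S m -> S n -> S (m + n)).

Lemma semigroup_muln n q : S q -> S (n * q).
Proof. by move=> Sq; elim: n => // n IHn; rewrite mulSn; apply: SD. Qed.

(** The nonnegative elements of the subgroup of the integers generated by [S], written without
    subtraction. *)
Definition is_gap d := exists2 q, S q & S (q + d).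

Lemma is_gapD a b : is_gap a -> is_gap b -> is_gap (a + b).
Proof.
move=> [q Sq Sqa] [r Sr Srb]; exists (q + r); first exact: SD.
by rewrite addnACA; apply: SD.
Qed.

Lemma is_gap_muln n a : is_gap a -> is_gap (n * a).
Proof.
move=> Sa; elim: n => [|n IHn]; first by exists 0.
by rewrite mulSn; apply: is_gapD.
Qed.

(** By Bezout, [u * a = v * b + gcdn a b]. The elements [q + (r + v * b)] and [r + (q + u * a)] of
    [S] therefore differ by the gcd. *)
Lemma is_gap_gcdn a b : is_gap a -> is_gap b -> is_gap (gcdn a b).
Proof.
move=> Sa Sb; have [-> | a_gt0] := posnP a; first by rewrite gcd0n.
case: (egcdnP b a_gt0) => u v uv _.
have [q Sq Sqa] := is_gap_muln u Sa; have [r Sr Srb] := is_gap_muln v Sb.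
exists (q + (r + v * b)); first exact: SD.
have -> : q + (r + v * b) + gcdn a b = r + (q + u * a) by lia.
exact: SD.
Qed.

(** With [q = t * k], both [t * k] and [t.+1 * k] lie in [S]. If [n = l * k] with [t * t <= l], then
    [l] has quotient [a] and remainder [r] by [t] with [r < t <= a], and
    [l = (a - r) * t + r * t.+1]. *)
Lemma semigroup_multiples k :
  is_gap k -> (forall q, S q -> k %| q) ->
  exists N, forall n, N <= n -> k %| n -> S n.
Proof.
move=> [q Sq Sqk] dvdS; have [t qt] := dvdnP (dvdS q Sq).
exists (t * t * k) => n Nn /dvdnP[l nl].
have [k0 | k_gt0] := posnP k; first by rewrite nl k0 muln0.
have [t0 | t_gt0] := posnP t.
  by rewrite nl; apply: semigroup_muln; move: Sqk; rewrite qt t0.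
have le_ttl : t * t <= l by move: Nn; rewrite nl leq_pmul2r.
have rt : l %% t < t by rewrite ltn_mod.
have ta : t <= l %/ t by rewrite leq_divRL.
have -> : n = (l %/ t - l %% t) * q + l %% t * (q + k).
  rewrite nl qt {1}(divn_eq l t).
  have := subnK (ltnW (leq_trans rt ta)); move: (l %/ t) (l %% t) => a r.
  by move: (a - r) => s <-; nia.
by apply: SD; apply: semigroup_muln.
Qed.

End Semigroup.

(** * Walks of prescribed length *)

Section Walks.
Variables (T : finType) (e : rel T).
Local Notation walk := (digraph_power e).

Lemma walkP n x y :
  reflect (exists c : seq T, [/\ size c = n, path e x c & last x c = y])
          (walk n x y).
Proof.
apply: (iffP existsP) => [[c /andP[ec /eqP <-]] | [c [sz_c ec cy]]].
  by exists c; rewrite size_tuple.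
by exists (Tuple (introT eqP sz_c)); rewrite ec cy /=.
Qed.

Lemma walk0 x y : walk 0 x y = (x == y).
Proof.
apply/walkP/eqP => [[c [/size0nil -> _]] // | <-]; by exists [::].
Qed.

Lemma walkD m n x z :
  walk (m + n) x z <-> exists2 y, walk m x y & walk n y z.
Proof.
split=> [/walkP[c [sz_c ec cz]] | [y /walkP[c [<- ec <-]] /walkP[d [<- ed <-]]]].
  move: ec cz; rewrite -{1 2}(cat_take_drop m c) cat_path last_cat.
  case/andP=> ec ed dz; exists (last x (take m c)); apply/walkP.
    by exists (take m c); rewrite size_takel // sz_c leq_addr.
  by exists (drop m c); rewrite size_drop sz_c addKn.
by apply/walkP; exists (c ++ d); rewrite size_cat cat_path last_cat ec.
Qed.

Lemma walk1 x y : walk 1 x y = e x y.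
Proof.
apply/walkP/idP => [[c [sz_c ec cy]] | xy].
  by case: c sz_c ec cy => [|z [|? ?]] //= _ /andP[xz _] <-.
by exists [:: y]; rewrite /= xy.
Qed.

Lemma walkS n x z : walk n.+1 x z <-> exists2 y, e x y & walk n y z.
Proof.
rewrite -add1n; split=> [/walkD[y] | [y xy yz]]; first by rewrite walk1; exists y.
by apply/walkD; exists y; rewrite ?walk1.
Qed.

Lemma walkSr n x z : walk n.+1 x z <-> exists2 y, walk n x y & e y z.
Proof.
rewrite -addn1; split=> [/walkD[y] | [y xy yz]]; first by rewrite walk1; exists y.
by apply/walkD; exists y; rewrite ?walk1.
Qed.

Lemma connect_walk x y : connect e x y <-> exists n, walk n x y.
Proof.
split=> [/connectP[c ec ->] | [n /walkP[c [_ ec <-]]]].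
  by exists (size c); apply/walkP; exists c.
by apply/connectP; exists c.
Qed.

End Walks.

(** * Imprimitivity classes and phases of one strong component *)

Section StrongComponent.
Variables (T : finType) (e : rel T) (A : {set T}) (k : nat) (U : 'I_k -> {set T}).
Local Notation walk := (digraph_power e).
Hypotheses (A_strong : forall x, x \in A -> A = strong_component e x)
  (kE : k = imprimitivity_index e A) (U_sets : imprimitivity_sets e A U).

Lemma strong_componentP x y :
  x \in A -> (y \in A) = connect e x y && connect e y x.
Proof. by move=> /A_strong->; rewrite inE. Qed.

Lemma imprimitivity_set_sub a x : x \in U a -> x \in A.
Proof.
case: U_sets => _ /and3P[/eqP <- _ _] _ xUa.
by apply/bigcupP; exists (U a) => //; apply: imset_f.
Qed.

Lemma imprimitivity_set_cover x : x \in A -> exists a, x \in U a.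
Proof.
case: U_sets => _ /and3P[/eqP <- _ _] _.
by case/bigcupP=> _ /imsetP[a _ ->]; exists a.
Qed.

Lemma imprimitivity_set_uniq a b x : x \in U a -> x \in U b -> a = b.
Proof.
case: U_sets => U_inj /and3P[_ /trivIsetP dis _] _ xa xb.
apply/eqP; apply: contraTT xb => ab.
have := dis (U a) (U b) (imset_f _ isT) (imset_f _ isT).
by rewrite (inj_eq U_inj) => /(_ ab)/disjointFr->.
Qed.

Lemma imprimitivity_set_nonempty a : exists x, x \in U a.
Proof.
case: U_sets => _ /and3P[_ _ n0] _; apply/set0Pn; apply: contraNneq n0 => <-.
exact: imset_f.
Qed.

(** The walk cannot leave [A]: [y] leads back to [x], so each vertex on the way is strongly
    connected to [x]. Hence every arc advances the class by one. *)
Lemma walk_class n x y a b :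
  x \in U a -> y \in U b -> walk n x y -> b = a + n %[mod k].
Proof.
elim: n x a => [|n IHn] x a xa yb.
  rewrite walk0 => /eqP xy; rewrite addn0; congr (nat_of_ord _ %% _).
  by apply: (imprimitivity_set_uniq yb); rewrite -xy.
case/walkS=> z xz zy; have xA := imprimitivity_set_sub xa.
have zA : z \in A.
  have := strong_componentP y xA; rewrite (imprimitivity_set_sub yb).
  case/esym/andP=> _ yx; rewrite (strong_componentP z xA) (connect1 xz) /=.
  by apply: connect_trans yx; apply/connect_walk; exists n.
case: U_sets => _ _ /(_ x z xA zA xz)[j [xj zj]].
rewrite (IHn z _ zj yb zy) (imprimitivity_set_uniq xa xj) /= modnDml.
by rewrite addSnnS.
Qed.

Lemma walk_same_class_dvdn n x : x \in A -> walk n x x -> k %| n.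
Proof.
case/imprimitivity_set_cover=> a xa /(walk_class xa xa)/eqP.
by rewrite -{1}(addn0 a) eqn_modDl mod0n eq_sym.
Qed.

(* A detour from [x] through a simple cycle of length [n] produces closed walks
   at [x] whose lengths differ by [n]. *)
Lemma closed_walk_gap x : x \in A -> is_gap (fun n => walk n x x) k.
Proof.
move=> xA.
have walkxx m n : walk m x x -> walk n x x -> walk (m + n) x x.
  by move=> xx yy; apply/walkD; exists x.
rewrite kE; apply: (big_rec (is_gap _)); first by exists 0; rewrite walk0.
move=> n g /existsP[c /andP[/andP[ec _] /allP cA]] gap_g.
apply: is_gap_gcdn => //; first by rewrite walk0.
case: c ec cA => -[|y c] /= /eqP sz_c ec cA.
  by rewrite -sz_c; exists 0; rewrite walk0.
have /(_ (mem_head _ _)) := cA y; rewrite (strong_componentP y xA).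
case/andP=> /connect_walk[l xy] /connect_walk[l' yx].
exists (l + l'); first by apply/walkD; exists y.
rewrite -addnA (addnC l'); apply/walkD; exists y => //.
apply/walkD; exists y => //; apply/walkP; exists (rcons c y).
by rewrite size_rcons last_rcons.
Qed.

(** The lengths of closed walks at [x] form a semigroup with gap [k], so they include all large
    multiples of [k]. A fixed walk of length [l] from [x] to [y] is appended; [k] divides [n - l]
    because [n] and [l] both carry class [a] to class [b]. *)
Lemma long_walk : exists N, forall n, N <= n -> forall x y a b,
  x \in U a -> y \in U b -> b = a + n %[mod k] -> walk n x y.
Proof.
suff [N NP] : exists N, forall n, N <= n -> forall xy : T * T, forall a b,
    xy.1 \in U a -> xy.2 \in U b -> b = a + n %[mod k] -> walk n xy.1 xy.2.
  by exists N => n Nn x y; apply: (NP n Nn (x, y)).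
apply: eventually_forall => -[x y] /=.
have [xA | xA] := boolP (x \in A); last first.
  by exists 0 => n _ a b /imprimitivity_set_sub xA'; rewrite xA' in xA.
have [yA | yA] := boolP (y \in A); last first.
  by exists 0 => n _ a b _ /imprimitivity_set_sub yA'; rewrite yA' in yA.
have [N NP] : exists N, forall n, N <= n -> k %| n -> walk n x x.
  apply: semigroup_multiples (closed_walk_gap xA) _; first by rewrite walk0.
    by move=> m n xx xx'; apply/walkD; exists x.
  by move=> q; apply: walk_same_class_dvdn.
have := strong_componentP y xA; rewrite yA => /esym/andP[/connect_walk[l xy] _].
exists (N + l) => n Nn a b xa yb ab.
rewrite -(@subnK l n) ?(leq_trans (leq_addl _ _) Nn) //.
apply/walkD; exists x => //; apply: NP; first lia.
have := walk_class xa yb xy; rewrite ab => /eqP.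
by rewrite eqn_modDl eqn_mod_dvd //; lia.
Qed.

(* [a = c + n] in Z_k: time is counted backwards, so that [c] does not depend on
   when [u] enters [A]. *)
Definition phase (u : T) (c : 'I_k) :=
  exists n x (a : 'I_k), [/\ walk n u x, x \in U a & a = c + n %[mod k]].

Lemma phase_self x a : x \in U a -> phase x a.
Proof. by move=> xa; exists 0, x, a; rewrite walk0 addn0. Qed.

Lemma phase_uniq x a c : x \in U a -> phase x c -> c = a.
Proof.
move=> xa [n [y [b [xy yb]]]].
rewrite (walk_class xa yb xy) => /eqP.
by rewrite eqn_modDr !modn_small // => /eqP ac; apply: val_inj.
Qed.

Lemma phase_walk u c : phase u c ->
  exists N, forall m, N <= m -> forall y (b : 'I_k),
    y \in U b -> b = c + m %[mod k] -> walk m u y.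
Proof.
move=> [n [x [a [ux xa ac]]]].
have [N NP] := long_walk.
exists (n + N) => m Nm y b yb bc; have nm := leq_trans (leq_addr N n) Nm.
rewrite -(subnKC nm); apply/walkD; exists x => //; apply: NP xa yb _.
  by rewrite leq_subRL.
by rewrite bc -(modnDml a) ac modnDml -addnA subnKC.
Qed.

Lemma walk_phase n u y : walk n u y -> y \in A ->
  exists c (a : 'I_k), [/\ phase u c, y \in U a & a = c + n %[mod k]].
Proof.
move=> uy /imprimitivity_set_cover[a ya].
have k_gt0 : 0 < k by case: (k) a {ya} => // -[].
(* The residue of [a - n], with [k - n %% k] in place of [- n]. *)
pose c := Ordinal (ltn_pmod (a + (k - n %% k)) k_gt0).
have ac : a = c + n %[mod k].
  rewrite /= modnDml -addnA -modnDmr -(modnDmr (k - _)) subnK ?modnn ?addn0 //.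
  by rewrite ltnW // ltn_mod.
by exists c, a; split=> //; exists n, y, a.
Qed.

End StrongComponent.

(** Moving [j] to the left-hand side turns the integer congruence into one of natural numbers. *)
Lemma mem_shifted_L (T : finType) (e : rel T) (k : nat) (U : 'I_k -> {set T})
    (v : T) (i : nat) (j l : 'I_k) :
  l \in shifted_L e U v i j <->
  exists2 r, r \in Lambda e U v & l + j = r + i + 1 %[mod k].
Proof.
have eqE (r : 'I_k) :
    (l%:Z == (r%:Z - j%:Z) + i%:Z + 1 %[mod k%:Z])%Z =
    (l + j == r + i + 1 %[mod k]).
  rewrite -(eqz_modDr j%:Z) -eqz_nat -!modz_nat.
  by congr (_ == modz _ _); lia.
rewrite inE; split=> [/existsP[r /andP[rL]] | [r rL lr]].
  by rewrite eqE => /eqP; exists r.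
by apply/existsP; exists r; rewrite rL eqE; apply/eqP.
Qed.

(** * Reachability along the linear listing *)

Section LinearListing.
Variables (T : finType) (e : rel T) (eta : nat) (D : nat -> {set T}).
Hypotheses (e_loopless : irreflexive e) (e_weak : weakly_connected e).
Hypothesis D_listing : linear_listing e eta D.
Local Notation walk := (digraph_power e).

Definition component_index x :=
  (index (strong_component e x) [seq D i | i <- iota 1 eta]).+1.
Local Notation idx := component_index.

Lemma strong_component_eq x y :
  y \in strong_component e x -> strong_component e x = strong_component e y.
Proof.
rewrite inE => /andP[xy yx]; apply/setP=> z; rewrite !inE.
apply/andP/andP=> -[c1 c2]; split.
- exact: connect_trans yx c1.
- exact: connect_trans c2 xy.
- exact: connect_trans xy c1.
- exact: connect_trans c2 yx.
Qed.

Lemma index_listing x :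
  strong_component e x \in [seq D i | i <- iota 1 eta].
Proof.
by case: D_listing => /perm_mem-> _; rewrite mem_enum; apply: imset_f.
Qed.

Lemma component_index_bounds x : 1 <= idx x <= eta.
Proof.
by have := index_listing x; rewrite -index_mem size_map size_iota.
Qed.

Lemma D_component_index x : D (idx x) = strong_component e x.
Proof.
have := nth_index set0 (index_listing x).
have /andP[_ ltidx] := component_index_bounds x.
by rewrite (nth_map 0) ?size_iota // nth_iota.
Qed.

Lemma mem_listing i x : 1 <= i <= eta -> (x \in D i) = (idx x == i).
Proof.
case: i => // i /= lt_i; apply/idP/eqP => [xDi | <-]; last first.
  by rewrite D_component_index inE connect0.
have DiE : D i.+1 = nth set0 [seq D i | i <- iota 1 eta] i.
  by rewrite (nth_map 0) ?size_iota // nth_iota.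
have [perm_D _] := D_listing.
have : D i.+1 \in [seq D i | i <- iota 1 eta].
  by rewrite DiE mem_nth // size_map size_iota.
rewrite (perm_mem perm_D) mem_enum => /imsetP[y _ DiE'].
congr _.+1; rewrite -(@strong_component_eq y) -?DiE' // DiE index_uniq //.
  by rewrite size_map size_iota.
by rewrite (perm_uniq perm_D) enum_uniq.
Qed.

Lemma listing_strong i x :
  1 <= i <= eta -> x \in D i -> D i = strong_component e x.
Proof.
by move=> i_eta; rewrite mem_listing // => /eqP <-; apply: D_component_index.
Qed.

Lemma listing_nonempty i : 1 <= i <= eta -> exists x, x \in D i.
Proof.
move=> i_eta; have : D i \in [seq D i | i <- iota 1 eta].
  by apply: map_f; rewrite mem_iota add1n ltnS.
case: D_listing => /perm_mem-> _; rewrite mem_enum => /imsetP[x _ ->].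
by exists x; rewrite inE connect0.
Qed.

Lemma component_indexE x y :
  (idx x == idx y) = connect e x y && connect e y x.
Proof.
rewrite -mem_listing ?component_index_bounds // D_component_index inE.
exact: andbC.
Qed.

Lemma arc_component_index x y :
  e x y -> idx y = idx x \/ idx y = (idx x).+1.
Proof.
move=> xy; have [-> | neq] := eqVneq (idx x) (idx y); first by left.
right; case: D_listing => _ /(_ (idx x) (idx y) x y); apply=> //;
  by rewrite ?component_index_bounds // mem_listing ?component_index_bounds.
Qed.

Lemma connect_component_index_le x y : connect e x y -> idx x <= idx y.
Proof.
case/connectP=> c + ->; elim: c x => //= z c IHc x /andP[xz /IHc].
by apply: leq_trans; case: (arc_component_index xz) => ->.
Qed.

(** Otherwise the vertices of index at most [i] would be closed under arcs in both directions,
    against weak connectedness. *)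
Lemma crossing_arc i :
  1 <= i < eta -> exists x y, [/\ idx x = i, idx y = i.+1 & e x y].
Proof.
move=> i_eta.
have [x xi] : exists x, x \in D i by apply: listing_nonempty; lia.
have [y yi] : exists y, y \in D i.+1 by apply: listing_nonempty; lia.
move: xi yi; rewrite !mem_listing; try lia; move=> /eqP xi /eqP yi.
have [/existsP[u /existsP[w /and3P[/eqP ui /eqP wi uw]]] | none] :=
  boolP [exists u, [exists w, [&& idx u == i, idx w == i.+1 & e u w]]].
  by exists u, w.
have arcP u w : e u w -> (idx u <= i) = (idx w <= i).
  move=> uw; have [-> // | wi] := arc_component_index uw.
  have : (idx u == i) && (idx w == i.+1) = false.
    apply/negP=> /andP[ui wi']; case/existsP: none; exists u.
    by apply/existsP; exists w; rewrite ui wi'.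
  lia.
have /closed_connect : closed [rel u w | e u w || e w u] [pred u | idx u <= i].
  by move=> u w /orP[] /arcP; rewrite !inE => ->.
by move=> /(_ _ _ (e_weak x y)); rewrite !inE xi yi leqnn ltnn.
Qed.

(** Induction on the index difference: inside its component [x] reaches the start of a crossing arc,
    which raises the index by one. *)
Lemma connect_component_index x y : connect e x y = (idx x <= idx y).
Proof.
apply/idP/idP => [|le_xy]; first exact: connect_component_index_le.
have [n] : exists n, idx y = idx x + n by exists (idx y - idx x); rewrite subnKC.
elim: n x {le_xy} => [|n IHn] x yx.
  by move: (component_indexE x y); rewrite yx addn0 eqxx => /esym/andP[].
have bx := component_index_bounds x; have by_ := component_index_bounds y.
have [u [w [ui wi uw]]] : exists u w, [/\ idx u = idx x, idx w = (idx x).+1 & e u w].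
  by apply: crossing_arc; lia.
have := component_indexE u x; rewrite ui eqxx => /esym/andP[_ xu].
apply: connect_trans xu (connect_trans (connect1 uw) (IHn w _)); lia.
Qed.

Lemma walk_component_index n x y : walk n x y -> idx x <= idx y.
Proof.
by move=> xy; apply: connect_component_index_le; apply/connect_walk; exists n.
Qed.

(** Each new arc begins a path to a vertex of [D p]. Its end still reaches [D p], so its index stays
    at most [p]. *)
Lemma walk_to n x p : idx x <= p <= eta -> ~~ trivial_component (D p) ->
  exists2 y, walk n x y & idx y <= p.
Proof.
move=> xp p_nontriv; elim: n => [|n [y xy yp]].
  by exists x; [rewrite walk0 | case/andP: xp].
have p_eta : 1 <= p <= eta by have := component_index_bounds x; lia.
(* Nontriviality gives a target other than [y], so that the path to it has a first arc. *)
have [z zp neq_zy] : exists2 z, z \in D p & z != y.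
  have [w wp] := listing_nonempty p_eta.
  have [wy | ] := eqVneq w y; last by exists w.
  have := p_nontriv; rewrite /trivial_component (cardsD1 w) wp.
  rewrite -[1%N]addn0 eqn_add2l cards_eq0 => /set0Pn[z].
  by rewrite !inE wy => /andP[]; exists z.
move: zp; rewrite mem_listing // => /eqP zp.
have /connectP[[|u c] /= ] : connect e y z by rewrite connect_component_index zp.
  by move=> _ zy; rewrite zy eqxx in neq_zy.
case/andP=> yu uc zE; exists u; first by apply/walkSr; exists y.
by rewrite -zp -connect_component_index; apply/connectP; exists c.
Qed.

Local Notation adj n := (competition_graph (walk n)).

Lemma adjP n u w :
  u != w -> reflect (exists z, walk n u z /\ walk n w z) (adj n u w).
Proof.
rewrite /competition_graph [X in reflect _ X]/= => ->.
by apply: (iffP existsP) => -[z]; [case/andP | case=> uz wz]; exists z;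
  rewrite ?uz.
Qed.

Lemma adj_persists m n u w z p :
  u != w -> m <= n -> p <= eta -> ~~ trivial_component (D p) ->
  walk m u z -> walk m w z -> idx z <= p -> adj n u w.
Proof.
move=> uw mn p_eta p_nontriv uz wz zp; apply/adjP => //.
have [|y zy _] := @walk_to (n - m) z p _ p_nontriv; first by rewrite zp.
by exists y; rewrite -(subnKC mn); split; apply/walkD; exists z.
Qed.

(** * The tail of trivial components *)

Section Tail.
Variable p : nat.
Hypothesis tail_trivial :
  forall i, p < i <= eta -> trivial_component (D i).

(** An arc inside a one-vertex component would be a loop. *)
Lemma tail_arc x y : p < idx y -> e x y -> idx y = (idx x).+1.
Proof.
move=> py xy; have [yx | //] := arc_component_index xy.
have /cards1P[z Dz] := @tail_trivial (idx y) ltac:(have := component_index_bounds y; lia).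
have : x \in D (idx y) by rewrite mem_listing ?component_index_bounds // yx.
have : y \in D (idx y) by rewrite mem_listing ?component_index_bounds.
by rewrite Dz !inE => /eqP yz /eqP xz; move: xy; rewrite yz xz e_loopless.
Qed.

Lemma tail_inj x y : p < idx x -> idx x = idx y -> x = y.
Proof.
move=> px xy.
have /cards1P[z Dz] := @tail_trivial (idx x) ltac:(have := component_index_bounds x; lia).
have : x \in D (idx x) by rewrite mem_listing ?component_index_bounds.
have : y \in D (idx x) by rewrite mem_listing ?component_index_bounds // xy.
by rewrite Dz !inE => /eqP-> /eqP->.
Qed.

Lemma tail_walk n x y : p < idx x -> walk n x y -> idx y = idx x + n.
Proof.
elim: n y => [|n IHn] y px; first by rewrite walk0 addn0 => /eqP->.
case/walkSr=> z xz zy; rewrite addnS -(IHn z) //.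
apply: (tail_arc _ zy).
by have := walk_component_index xz; have [-> | ->] := arc_component_index zy; lia.
Qed.

Lemma tail_walk_bound n x y : p < idx x -> walk n x y -> n < eta.
Proof.
move=> px /(tail_walk px) yx.
by have := component_index_bounds x; have := component_index_bounds y; lia.
Qed.

(** The walk is cut at the arc leaving [D p]. This arc and every later one raise the index by
    exactly one, so [idx z - p] arcs follow [y]. *)
Lemma walk_into_tail m x z : idx x <= p < idx z -> walk m x z ->
  exists n y v, [/\ walk n x y, e y v, idx y = p, idx v = p.+1
                  & m = n + (idx z - p)].
Proof.
elim: m z => [|m IHm] z xpz; first by rewrite walk0 => /eqP xz; move: xpz; rewrite xz; lia.
case/walkSr=> z' xz' z'z; have z'zE := tail_arc (proj2 (andP xpz)) z'z.
have [pz' | z'p] := ltnP p (idx z').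
  have [|n [y [v [xy yv yp vp mE]]]] := IHm z' _ xz'; first lia.
  by exists n, y, v; split=> //; lia.
by exists m, z', z; split=> //; lia.
Qed.

(** Some walk leads from [v] to the component of index [p.+1 + i], and the indices force its length
    to be [i]. *)
Lemma walk_along_tail i v :
  idx v = p.+1 -> i < eta - p -> exists y, walk i v y.
Proof.
move=> vp i_lt.
have [z zD] : exists z, z \in D (p.+1 + i) by apply: listing_nonempty; lia.
move: zD; rewrite mem_listing; last lia; move/eqP=> zi.
have /connect_walk[n vz] : connect e v z by rewrite connect_component_index; lia.
have pv : p < idx v by rewrite vp.
by exists z; have <- : n = i by have := tail_walk pv vz; lia.
Qed.

End Tail.

(** * Competition on the tail *)

Section Phases.
Variables (p : nat) (v : T) (k : nat) (U : 'I_k -> {set T}).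
Hypothesis tail_trivial :
  forall i, p < i <= eta -> trivial_component (D i).
Hypotheses (p_eta : 1 <= p < eta) (Dp1 : D p.+1 = [set v])
  (kE : k = imprimitivity_index e (D p)) (U_sets : imprimitivity_sets e (D p) U).

Let Dp_strong x : x \in D p -> D p = strong_component e x.
Proof. by apply: listing_strong; lia. Qed.

Let idx_v : idx v = p.+1.
Proof. by apply/eqP; rewrite -mem_listing ?Dp1 ?inE //; lia. Qed.

(** Here [i] counts the arcs travelled beyond [v]; its largest value [eta - p - 1] corresponds to
    the last component. *)
Definition tail_competition (c c' : 'I_k) := \bigcup_(0 <= i < eta - p)
  (shifted_L e U v i c :&: shifted_L e U v i c').

Lemma mem_tail_competition c c' l :
  l \in tail_competition c c' <-> exists i (r r' : 'I_k),
    [/\ i < eta - p, r \in Lambda e U v, r' \in Lambda e U v,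
        l + c = r + i + 1 %[mod k] & l + c' = r' + i + 1 %[mod k]].
Proof.
rewrite /tail_competition big_mkord; split.
  case/bigcupP=> i _; rewrite inE => /andP[/mem_shifted_L[r rL lr]].
  by case/mem_shifted_L=> r' r'L lr'; exists i, r, r'.
move=> [i [r [r' [i_lt rL r'L lr lr']]]]; apply/bigcupP.
exists (Ordinal i_lt) => //=; rewrite inE.
by apply/andP; split; apply/mem_shifted_L; [exists r | exists r'].
Qed.

(** By their phases, [u] and [w] reach in-neighbors of [v] in classes [r] and [r'] after [m - i.+1]
    steps. One arc to [v] and [i] arcs along the tail then bring both to the same vertex. *)
Lemma tail_competition_adj u w c c' : u != w -> phase e U u c -> phase e U w c' ->
  exists N, forall m, N <= m ->
    (exists2 l, l \in tail_competition c c' & l = m %[mod k]) -> adj m u w.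
Proof.
move=> uw uc wc'; have [N NP] := phase_walk Dp_strong kE U_sets uc.
have [N' NP'] := phase_walk Dp_strong kE U_sets wc'.
(* The final [i.+1 <= eta] arcs leave at least [N + N'] steps for reaching the in-neighbors. *)
exists (N + N' + eta) => m le_m [l].
case/mem_tail_competition=> i [r [r' [i_lt rL r'L lr lr']]] lm.
have lt_im : i < m.
  by apply: leq_trans i_lt (leq_trans (leq_subr _ _) (leq_trans _ le_m)); apply: leq_addl.
have [le_Nm le_N'm] : N <= m - i.+1 /\ N' <= m - i.+1.
  by move: le_m i_lt; clear; lia.
have [z vz] := walk_along_tail tail_trivial idx_v i_lt.
have reach x d (s : 'I_k) : s \in Lambda e U v ->
    l + d = s + i + 1 %[mod k] ->
    (forall y b, y \in U b -> b = d + (m - i.+1) %[mod k] ->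
       walk (m - i.+1) x y) ->
    walk m x z.
  rewrite inE => /set0Pn[y]; rewrite !inE => /andP[ys yv] ls walk_x.
  rewrite -(subnK lt_im).
  apply/walkD; exists y; last by apply/walkS; exists v.
  apply: walk_x ys _; apply/eqP.
  rewrite -(eqn_modDr i.+1) -addnA subnK //.
  by rewrite -addn1 addnA -ls -(modnDml l) lm modnDml addnC.
apply/adjP => //; exists z; split.
  by apply: reach rL lr _ => y b; apply: NP.
by apply: reach r'L lr' _ => y b; apply: NP'.
Qed.

(** Both walks enter the tail at [v], the only vertex of index [p.+1], and then make the same number
    [idx z - p.+1] of steps. This number is the common [i], and the classes left on entering lie in
    [Lambda e U v]. *)
Lemma adj_tail_competition m u w z : idx u <= p -> idx w <= p -> p < idx z ->
  walk m u z -> walk m w z ->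
  exists c c', [/\ phase e U u c, phase e U w c' &
                   exists2 l, l \in tail_competition c c' & l = m %[mod k]].
Proof.
move=> up wp pz.
have enter x : idx x <= p -> walk m x z ->
    exists c (a : 'I_k), [/\ phase e U x c, a \in Lambda e U v &
      m + c = a + (idx z - p.+1) + 1 %[mod k]].
  move=> xp xz; have xpz : idx x <= p < idx z by rewrite xp.
  have [n [y [v' [xy yv yp v'p mE]]]] := walk_into_tail tail_trivial xpz xz.
  have v'v : v' = v by apply: (tail_inj tail_trivial); rewrite v'p ?idx_v.
  have yD : y \in D p by rewrite mem_listing ?yp //; lia.
  have [c [a [xc ya ac]]] := walk_phase U_sets xy yD.
  exists c, a; split=> //.
    by rewrite inE; apply/set0Pn; exists y; rewrite !inE ya -v'v yv.
  have -> : m + c = c + n + (idx z - p) by lia.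
  rewrite -(modnDml (c + n)) -ac modnDml; congr (_ %% _); lia.
move=> /(enter u up)[c [a [uc aL ac]]] /(enter w wp)[c' [a' [wc' a'L ac']]].
have k_gt0 : 0 < k by case: (k) a {aL ac} => // -[].
exists c, c'; split=> //; exists (Ordinal (ltn_pmod m k_gt0)); last by rewrite /= modn_mod.
apply/mem_tail_competition; exists (idx z - p.+1), a, a'.
split=> //; rewrite /= ?modnDml //.
by have := component_index_bounds z; lia.
Qed.

End Phases.
End LinearListing.

(** * Convergence of the graph sequence *)

(** There are finitely many pairs, and each stabilises: under the second alternative a pair is
    either never adjacent or adjacent from some time on. *)
Lemma converges_pointwise (T : finType) (G : nat -> rel T) :
  (forall u w, (exists N, forall m, N <= m -> G m u w = false) \/
     (forall m, G m u w -> exists N, forall n, N <= n -> G n u w)) ->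
  graph_sequence_converges G.
Proof.
move=> ev_G.
have [|N NP] := @eventually_forall (T * T)%type
    (fun uw n => forall m, n <= m -> G m uw.1 uw.2 = G n uw.1 uw.2).
  move=> [u w] /=.
  have [[N NP] | ] : (exists N, forall m, N <= m -> G m u w = false) \/
      (exists N, forall m, N <= m -> G m u w = true).
  - have [|ev] := ev_G u w; first by left.
    have [[m /ev] | none] := classic (exists m, G m u w); first by right.
    by left; exists 0 => m _; apply/negP=> Gm; apply: none; exists m.
  - by exists N => n Nn m nm; rewrite !NP // (leq_trans Nn).
  - by case=> N NP; exists N => n Nn m nm; rewrite !NP // (leq_trans Nn).
exists N.+1 => // m Nm u w.
by apply: (NP _ _ (u, w)).
Qed.

Theorem theorem2p4 (T : finType) (e : rel T) (eta : nat) (D : nat -> {set T})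
    (U : forall i : nat, 'I_(imprimitivity_index e (D i)) -> {set T})
    (e_loopless : irreflexive e)
    (e_weak : weakly_connected e)
    (D_listing : linear_listing e eta D)
    (U_sets : forall i : nat, 1 <= i <= eta -> ~~ trivial_component (D i) ->
       imprimitivity_sets e (D i) (U i)) :
  graph_sequence_converges (fun m => competition_graph (digraph_power e m))
  <->
  [\/ forall i : nat, 1 <= i <= eta -> trivial_component (D i),
      ~~ trivial_component (D eta)
    | [/\ trivial_component (D eta),
          exists2 i : nat, 1 <= i <= eta & ~~ trivial_component (D i)
        & forall (p : nat) (v : T),
            1 <= p <= eta -> ~~ trivial_component (D p) ->
            (forall i : nat, p < i <= eta -> trivial_component (D i)) ->
            D p.+1 = [set v] ->
            forall j1 j2 : 'I_(imprimitivity_index e (D p)), j1 != j2 ->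
              let W := \bigcup_(0 <= i < eta - p)
                 (shifted_L e (U p) v i j1 :&: shifted_L e (U p) v i j2) in
              W = set0 \/ W = setT]].
Proof.
have [all_triv | not_triv] :=
  classic (forall i, 1 <= i <= eta -> trivial_component (D i)).
  split=> _; first by apply: Or31.
  apply: converges_pointwise => u w; left; exists eta => m le_m; apply/negP.
  have [-> | uw] := eqVneq u w; first by rewrite /competition_graph /= eqxx.
  case/(adjP _ _ uw)=> z [uz _].
  (* With [p = 0] all components belong to the tail, so every walk has fewer than [eta] arcs. *)
  have u_gt0 : 0 < component_index e eta D u by [].
  have := tail_walk_bound e_loopless D_listing all_triv u_gt0 uz.
  by rewrite ltnNge le_m.
have [i0 i0_eta i0_nontriv] : exists2 i, 1 <= i <= eta & ~~ trivial_component (D i).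
  apply: NNPP => none; apply: not_triv => i i_eta; apply/negPn/negP=> i_nontriv.
  by apply: none; exists i.
have [eta_triv | eta_nontriv] := boolP (trivial_component (D eta)); last first.
  split=> _; first by apply: Or32.
  (* Every vertex has index at most [eta], so any common prey can be followed forever. *)
  apply: converges_pointwise => u w; right=> m.
  have [-> | uw] := eqVneq u w; first by rewrite /competition_graph /= eqxx.
  case/(adjP _ _ uw)=> z [uz wz]; exists m => n mn.
  apply: (adj_persists e_weak D_listing uw mn (leqnn eta) eta_nontriv uz wz).
  by case/andP: (component_index_bounds D_listing z).
have lt_eta p : 1 <= p <= eta -> ~~ trivial_component (D p) -> 1 <= p < eta.
  case/andP=> -> le_p p_nontriv; rewrite ltn_neqAle le_p andbT.
  by apply: contraNneq p_nontriv => ->.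
split=> [[N _ NP] | [// | // | [_ _ W_cond]]].
  pose G m := competition_graph (digraph_power e m).
  have {}NP m : N <= m -> G m =2 G N by apply: NP.
  apply: Or33; split=> //; first by exists i0.
  move=> p v p_eta p_nontriv tail_triv Dp1 j1 j2 j12 WW.
  have lt_p := lt_eta p p_eta p_nontriv.
  have Up := U_sets p p_eta p_nontriv.
  have Dp_strong := fun x => @listing_strong _ _ _ _ D_listing p x p_eta.
  have idx_U x j : x \in U p j -> component_index e eta D x = p.
    move/(imprimitivity_set_sub Up).
    by rewrite (mem_listing D_listing) // => /eqP.
  (* An element [l] of the union makes [u] and [w] adjacent at large times congruent to [l], hence,
     by convergence, at all times from [N] on. A time congruent to an arbitrary [l'] then puts [l']
     in the union. *)
  have [W0 | /set0Pn[l lW]] := eqVneq WW set0; [by left | right].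
  have [u uj1] := imprimitivity_set_nonempty Up j1.
  have [w wj2] := imprimitivity_set_nonempty Up j2.
  have uw : u != w.
    apply: contraNneq j12 => uw; apply/eqP.
    by apply: (imprimitivity_set_uniq Up uj1); rewrite uw.
  have [M MP] := tail_competition_adj e_loopless e_weak D_listing tail_triv
    lt_p Dp1 erefl Up uw (phase_self e uj1) (phase_self e wj2).
  have k_gt0 : 0 < imprimitivity_index e (D p) by apply: leq_trans (ltn_ord j1).
  have large (a b : nat) : b <= a + b * imprimitivity_index e (D p).
    by apply: leq_trans (leq_addl _ _); apply: leq_pmulr.
  have adj_N : G N u w.
    rewrite -(NP (l + (N + M) * imprimitivity_index e (D p))).
      apply: MP; last by exists l; rewrite // addnC modnMDl.
      exact: leq_trans (leq_addl _ _) (large _ _).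
    exact: leq_trans (leq_addr _ _) (large _ _).
  apply/setP=> l'; rewrite inE.
  pose m := l' + N * imprimitivity_index e (D p).
  have /(adjP _ _ uw)[z [uz wz]] : G m u w by rewrite NP //; apply: large.
  (* A common prey of index at most [p] would lie in a single class of [D p], which forces
     [j1 = j2]. *)
  have [zp | pz] := leqP (component_index e eta D z) p.
    have zDp : z \in D p.
      rewrite (mem_listing D_listing) // eqn_leq zp /=.
      by rewrite -(idx_U u j1 uj1); apply: (walk_component_index D_listing uz).
    have [b zb] := imprimitivity_set_cover Up zDp.
    have := walk_class Dp_strong Up uj1 zb uz.
    rewrite (walk_class Dp_strong Up wj2 zb wz) => /eqP.
    rewrite eqn_modDr !modn_small // => /eqP j21.
    by case/eqP: j12; apply: val_inj.
  have [||c [c' [uc wc' [l'' l''W l''m]]]] :=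
    adj_tail_competition e_loopless D_listing tail_triv lt_p Dp1 erefl Up _ _ pz uz wz.
  - by rewrite (idx_U u j1).
  - by rewrite (idx_U w j2).
  have <- : l'' = l'.
    apply: val_inj; move: l''m.
    by rewrite /m addnC modnMDl !modn_small.
  move: l''W; rewrite (phase_uniq Dp_strong Up uj1 uc).
  by rewrite (phase_uniq Dp_strong Up wj2 wc').
have [p [p_eta p_nontriv tail_triv]] : exists p, [/\ 1 <= p <= eta,
    ~~ trivial_component (D p)
  & forall i, p < i <= eta -> trivial_component (D i)].
  pose nontriv i := (1 <= i <= eta) && ~~ trivial_component (D i).
  have ex_n : exists i, nontriv i by exists i0; rewrite /nontriv i0_eta.
  have bound i : nontriv i -> i <= eta by case/andP=> /andP[].
  case: (ex_maxnP ex_n bound) => p /andP[p_eta p_nontriv] p_max; exists p.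
  split=> // i /andP[pi i_eta]; apply/negPn/negP=> i_nontriv.
  have := p_max i; rewrite /nontriv i_nontriv i_eta (leq_trans _ pi) //.
  by rewrite leqNgt pi => /(_ isT).
have lt_p := lt_eta p p_eta p_nontriv.
have /cards1P[v Dp1] : trivial_component (D p.+1).
  by apply: tail_triv; rewrite ltnSn; case/andP: lt_p.
have Up := U_sets p p_eta p_nontriv.
have Dp_strong := fun x => @listing_strong _ _ _ _ D_listing p x p_eta.
pose idx := component_index e eta D.
apply: converges_pointwise => u w.
have [-> | uw] := eqVneq u w.
  by left; exists 0 => m _; rewrite /competition_graph /= eqxx.
have tail_not_adj x y : x != y -> p < idx x -> forall m, eta <= m ->
    competition_graph (digraph_power e m) x y = false.
  move=> xy px m le_m; apply/negP=> /(adjP _ _ xy)[z [xz _]].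
  have := tail_walk_bound e_loopless D_listing tail_triv px xz.
  by rewrite ltnNge le_m.
have [up | pu] := leqP (idx u) p; last first.
  by left; exists eta; apply: tail_not_adj.
have [wp | pw] := leqP (idx w) p; last first.
  left; exists eta => m le_m; apply/negP=> /(adjP _ _ uw)[z [uz wz]].
  have wu : w != u by rewrite eq_sym.
  have /negP[] := negbT (tail_not_adj w u wu pw m le_m).
  by apply/adjP => //; exists z.
right=> m /(adjP _ _ uw)[z [uz wz]].
have [zp | pz] := leqP (idx z) p.
  exists m => n mn; case/andP: p_eta => _ le_p.
  exact: (adj_persists e_weak D_listing uw mn le_p p_nontriv uz wz zp).
have [c [c' [uc wc' [l lW lm]]]] :=
  adj_tail_competition e_loopless D_listing tail_triv lt_p Dp1 erefl Up up wp pz uz wz.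
have k_gt0 : 0 < imprimitivity_index e (D p) by apply: leq_trans (ltn_ord c).
(* The condition on the union concerns distinct classes. With equal phases, [u] and [w] share preys
   in [D p] itself at all large times. *)
have [cc' | cc'] := eqVneq c c'.
  have [N NP] := phase_walk Dp_strong erefl Up uc.
  have [N' NP'] := phase_walk Dp_strong erefl Up wc'.
  exists (N + N') => n le_n; pose b := Ordinal (ltn_pmod (c + n) k_gt0).
  have [y yb] := imprimitivity_set_nonempty Up b.
  apply/adjP => //; exists y; split.
    by apply: NP yb _; rewrite ?modn_mod //; apply: leq_trans (leq_addr _ _) le_n.
  apply: NP' yb _; first by apply: leq_trans (leq_addl _ _) le_n.
  by rewrite /= modn_mod cc'.
(* The union contains [l], so it must be everything, and the residue of every large [n] lies in
   it. *)
have [W0 | WT] := W_cond p v p_eta p_nontriv tail_triv Dp1 c c' cc'.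
  by move: lW; rewrite /tail_competition W0 inE.
have [N NP] := tail_competition_adj e_loopless e_weak D_listing tail_triv
  lt_p Dp1 erefl Up uw uc wc'.
exists N => n le_n; apply: NP le_n _; exists (Ordinal (ltn_pmod n k_gt0)).
  by rewrite /tail_competition WT inE.
by rewrite /= modn_mod.
Qed.
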